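(* For any weighted digraph $\Gamma$ with Kirchhoff matrix $L$ and out forest dimension $v$, $$Q(1)=(I+L)^{-1}=s^{-1}\sum_{i=0}^{n-v}s_{n-v-i}\,(-L)^i,$$ where $s_k=\sum_{j=0}^{k}\sigma_j$ is the total weight of out forests of $\Gamma$ with at most $k$ arcs, $k=0,\dots,n-v$, and $s$ is the total weight of all out forests of $\Gamma$.
   Context: $\Gamma$ is a weighted digraph without loops with vertex set $\{1,\dots,n\}$, $n>1$; all arcs have strictly positive real weights; $\varepsilon_{ij}$ denotes the weight of the arc from $i$ to $j$, with $\varepsilon_{ij}=0$ if and only if there is no such arc. The Kirchhoff matrix $L=(\ell_{ij})$ is the $n\times n$ matrix with $\ell_{ij}=-\varepsilon_{ji}$ for $j\ne i$ and $\ell_{ii}=-\sum_{k\ne i}\ell_{ik}$. For $\tau>0$, $Q(\tau)=(I+\tau L)^{-1}$ (the inverse exists). A diverging forest is a digraph without (directed) circuits in which every vertex has indegree at most 1. An out forest of $\Gamma$ is a spanning subgraph of $\Gamma$ that is a diverging forest. The weight of a subgraph is the product of the weights of its arcs (1 if it has no arcs); the weight of a set of subgraphs is the sum of the weights of its elements (0 for the empty set). The out forest dimension $v$ is the minimum number of weak components of an out forest of $\Gamma$, so the maximum number of arcs of an out forest is $n-v$. $\sigma_k$ is the total weight of the set of all out forests of $\Gamma$ with $k$ arcs, and $s=\sum_{k=0}^{n-v}\sigma_k$. *)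

(* Defs.v *)
From HB Require Import structures.
From mathcomp Require Import all_boot all_order all_algebra.

Set Implicit Arguments.
Unset Strict Implicit.
Unset Printing Implicit Defensive.

Import Order.TTheory GRing.Theory Num.Theory.
Local Open Scope ring_scope.

(* [eps G i j] is the weight of the arc from [i] to [j]; the value 0 encodes
   the absence of an arc, so [eps] determines the digraph. *)
Record wdigraph (R : realFieldType) (n : nat) := WDigraph {
  eps : 'I_n -> 'I_n -> R;
  eps_ge0 : forall i j, 0 <= eps i j;
  eps_loopless : forall i, eps i i = 0
}.

Section SpanningSubgraphs.

(* A spanning digraph on the vertex set ['I_n] is given by its set of arcs,
   [(i, j)] being the arc from [i] to [j]. *)
Variable n : nat.
Implicit Type F : {set 'I_n * 'I_n}.

Definition arc_rel F : rel 'I_n := fun i j => (i, j) \in F.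

Definition indegree F (i : 'I_n) : nat := #|[set a in F | a.2 == i]|.

(* The vertices of a circuit are distinct, so its length is one of 1, ..., n. *)
Definition has_circuit F : bool :=
  [exists k : 'I_n, [exists c : k.+1.-tuple 'I_n, ucycleb (arc_rel F) c]].

Definition diverging_forest F : bool :=
  ~~ has_circuit F && [forall i, (indegree F i <= 1)%N].

Definition weak_components F : nat :=
  n_comp (fun i j => arc_rel F i j || arc_rel F j i) 'I_n.

End SpanningSubgraphs.

Section WeightedDigraph.

Variables (R : realFieldType) (n : nat) (G : wdigraph R n).

Definition arcs : {set 'I_n * 'I_n} := [set a | 0 < eps G a.1 a.2].

Definition Kirchhoff : 'M[R]_n :=
  \matrix_(i, j) (if j == i then - \sum_(k < n | k != i) (- eps G k i)
                  else - eps G j i).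

Definition Q (tau : R) : 'M[R]_n := invmx (1%:M + tau *: Kirchhoff).

Definition out_forests : {set {set 'I_n * 'I_n}} :=
  [set F : {set 'I_n * 'I_n} | (F \subset arcs) && diverging_forest F].

Definition weight (F : {set 'I_n * 'I_n}) : R := \prod_(a in F) eps G a.1 a.2.

Definition total_weight (A : {set {set 'I_n * 'I_n}}) : R :=
  \sum_(F in A) weight F.

(* The default value [n] does not affect the minimum: it is the number of weak
   components of the out forest without arcs. *)
Definition forest_dim : nat :=
  \big[minn/n]_(F in out_forests) weak_components F.

Definition sigma (k : nat) : R :=
  total_weight [set F : {set 'I_n * 'I_n} in out_forests | #|F| == k].

Definition sigma_le (k : nat) : R := \sum_(0 <= j < k.+1) sigma j.

End WeightedDigraph.

(* Main.v *)
Require Import Defs.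
From HB Require Import structures.
From mathcomp Require Import all_boot all_order all_algebra all_fingroup.

Set Implicit Arguments.
Unset Strict Implicit.
Unset Printing Implicit Defensive.

Import Order.TTheory GRing.Theory Num.Theory.
Local Open Scope ring_scope.

(* Expanding [det (I + X L)] multilinearly over the choices of a parent for each
   vertex gives the forest polynomial [sigma(X) = \sum_k sigma_k X^k], whose
   degree is at most [n - v].  For [t >= 0] the minimum principle shows that
   [(I + t L)^-1] has entries in [[0, 1]], so the entries of
   [adj (I + X L) = sigma(X) (I + X L)^-1] lie between [0] and [sigma] on the
   nonnegative axis, and their degree is at most [n - v] too.  The matrix
   coefficients [B_k] of the adjugate satisfy [B_(k+1) = sigma_(k+1) I - L B_k];
   unrolling this recurrence and setting [X = 1] gives the formula. *)

(** * Circuits as cyclic sequences of distinct vertices *)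

Section Circuits.

Variable n : nat.
Implicit Types (F : {set 'I_n * 'I_n}) (c : seq 'I_n).

Lemma has_circuitP F :
  reflect (exists2 c, c != [::] & ucycle (arc_rel F) c) (has_circuit F).
Proof.
apply: (iffP existsP) => [[k /existsP[c ucF]]|[c c_neq0 ucF]].
  exists (val c); last exact: ucF.
  by rewrite -size_eq0 size_tuple.
have le_cn : (size c <= n)%N.
  by rewrite -(card_uniqP (ucycle_uniq ucF)) -[leqRHS]card_ord max_card.
case: c c_neq0 ucF le_cn => // x c _ ucF le_cn.
exists (Ordinal le_cn); apply/existsP; exists (in_tuple (x :: c)).
exact: ucF.
Qed.

(** Arcs run from the parent [g x] to [x], so a cycle of the parent map is a circuit read
    backwards. *)
Lemma fcycle_has_circuit F (g : 'I_n -> 'I_n) c :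
    c != [::] -> uniq c -> fcycle g c ->
    {in c, forall x, (g x, x) \in F} ->
  has_circuit F.
Proof.
move=> c_neq0 uc gc gF; apply/has_circuitP; exists (rev c).
  by rewrite -size_eq0 size_rev size_eq0.
rewrite /ucycle rev_uniq uc rev_cycle andbT.
apply/(cycle_from_next uc) => x xc.
by have /eqP <- := next_cycle gc xc; exact: gF.
Qed.

End Circuits.

(** * Forest expansion of a determinant over a commutative ring *)

Section ForestDeterminant.

Variables (R : comNzRingType) (n : nat).
Implicit Types (f : {ffun 'I_n -> option 'I_n}) (w : 'I_n -> 'I_n -> R).

(** [f i] is the parent of [i], and [None] marks a root; the arc sets with all indegrees at most 1
    each arise exactly once. *)
Definition parent_arcs f : {set 'I_n * 'I_n} := [set a | f a.2 == Some a.1].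

Definition parent_mx f : 'M[R]_n :=
  \matrix_(i, j) ((i == j)%:R - (f i == Some j)%:R).

Lemma in_parent_arcs f i j : ((i, j) \in parent_arcs f) = (f j == Some i).
Proof. by rewrite inE. Qed.

(** The rows indexed by the circuit sum to zero, since the parent map permutes its vertices. *)
Lemma det_parent_mx_circuit f :
  has_circuit (parent_arcs f) -> \det (parent_mx f) = 0.
Proof.
case/has_circuitP=> c c_neq0 /andP[cF uc].
have prevE i : i \in c -> f i = Some (prev c i).
  by move=> ic; have := prev_cycle cF ic; rewrite /arc_rel in_parent_arcs => /eqP.
pose y : 'rV[R]_n := \row_i (i \in c)%:R.
have yM0 : y *m parent_mx f = 0.
  apply/rowP=> j; rewrite !mxE.
  under eq_bigr => i _ do rewrite !mxE mulrBr.
  rewrite sumrB; apply/eqP; rewrite subr_eq0; apply/eqP.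
  rewrite [RHS](reindex (next c)) /=; last first.
    by exists (prev c) => i _; rewrite ?prev_next ?next_prev.
  apply: eq_bigr => i _; rewrite mem_next.
  case: (boolP (i \in c)) => ic; last by rewrite !mul0r.
  by rewrite prevE ?mem_next// prev_next.
(* Over a ring, the adjugate turns this relation into [y] times the determinant being 0, and [y] has
   an entry equal to 1. *)
have : y *m parent_mx f *m \adj (parent_mx f) = 0 by rewrite yM0 mul0mx.
rewrite -mulmxA mul_mx_adj mul_mx_scalar.
case: c c_neq0 @y {cF uc prevE yM0} => // x c _ /= /rowP/(_ x).
by rewrite !mxE mem_head mulr1.
Qed.

(* A non-identity permutation with a non-zero term in the Leibniz expansion
   sends every point it moves to its parent, so it traces a circuit. *)
Lemma det_parent_mx_forest f :
  ~~ has_circuit (parent_arcs f) -> \det (parent_mx f) = 1.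
Proof.
move=> acyc; rewrite /determinant (bigD1 1%g) //= odd_perm1 expr0 mul1r.
rewrite big1 ?mul1r => [|i _]; last first.
  (* A diagonal entry differs from 1 only if [i] is its own parent, which is a circuit of length
     1. *)
  rewrite perm1 mxE eqxx; case: eqP => [fi|_]; last by rewrite subr0.
  case/negP: acyc; apply: (@fcycle_has_circuit _ _ id [:: i]) => //=.
    by rewrite eqxx.
  by move=> x; rewrite inE => /eqP->; rewrite in_parent_arcs fi.
rewrite big1 ?addr0 // => s s_neq1.
case: (pickP (fun i => (s i != i) && (f i != Some (s i)))) => [i /andP[si fi]|sf].
  by rewrite (bigD1 i) //= mxE eq_sym (negPf si) (negPf fi) subrr mul0r mulr0.
case: (pickP (fun i => s i != i)) => [i si|s_id]; last first.
  by case/eqP: s_neq1; apply/permP=> i; rewrite perm1; apply/eqP/negbFE/s_id.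
case/negP: acyc.
have fc : fcycle s (fingraph.orbit s i).
  exact/cycle_orbit/perm_inj.
apply: fcycle_has_circuit fc _; rewrite ?orbit_uniq //.
  by rewrite -size_eq0 size_orbit -lt0n fingraph.order_gt0.
move=> x; rewrite -fconnect_orbit => /iter_findex <-.
rewrite in_parent_arcs -iterS.
have moved k : s (iter k s i) != iter k s i.
  by elim: k => //= k IH; apply: contra IH => /eqP/perm_inj->.
by have := sf (iter (fingraph.findex s i x) s i); rewrite moved => /negbFE.
Qed.

Lemma indegree_parent_arcs f i : (indegree (parent_arcs f) i <= 1)%N.
Proof.
apply/card_le1_eqP => -[a b] [c d]; rewrite !inE /=.
move=> /andP[/eqP fb /eqP bi] /andP[/eqP fd /eqP di].
by move: fd; rewrite bi di -bi fb => -[->].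
Qed.

Lemma diverging_parent_arcs f :
  diverging_forest (parent_arcs f) = ~~ has_circuit (parent_arcs f).
Proof.
by rewrite /diverging_forest andbC; case: forallP => // -[]; exact: indegree_parent_arcs.
Qed.

Lemma prod_parent_arcs w f :
  \prod_(a in parent_arcs f) w a.1 a.2 =
  \prod_i (if f i is Some k then w k i else 1).
Proof.
transitivity (\prod_i \prod_(k | (k, i) \in parent_arcs f) w k i).
  rewrite pair_big_dep /= (reindex (fun p => (p.2, p.1))) /=; last first.
    by exists (fun p => (p.2, p.1)) => -[].
  by apply: eq_bigl => -[a b].
apply: eq_bigr => i _; under eq_bigl => k do rewrite in_parent_arcs.
case fi: (f i) => [k|]; last by rewrite big_pred0.
by rewrite (big_pred1 k) // => j; rewrite /= eq_sym; apply/eqP/eqP=> [[]|->].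
Qed.

Lemma sum_option (T : finType) (E : option T -> R) :
  \sum_o E o = E None + \sum_k E (Some k).
Proof.
rewrite (bigD1 None) //=; congr (_ + _).
rewrite (reindex_omap Some id) /=; last by case.
by apply: eq_bigl => k; rewrite eqxx.
Qed.

(* Row [i] is a combination of the rows [e_i] (no parent, coefficient 1) and
   [e_i - e_k] (parent [k], coefficient [w k i]); expanding multilinearly gives
   one term for each choice of parents. *)
Lemma det_forest w :
  \det (\matrix_(i, j) ((i == j)%:R * (1 + \sum_k w k i) - w j i)) =
  \sum_(F : {set 'I_n * 'I_n} | diverging_forest F) \prod_(a in F) w a.1 a.2.
Proof.
pose c i o := if o is Some k then w k i else 1.
have -> : \sum_(F : {set 'I_n * 'I_n} | diverging_forest F)
             \prod_(a in F) w a.1 a.2 =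
    \sum_(f : {ffun 'I_n -> option 'I_n}) (\prod_i c i (f i)) * \det (parent_mx f).
  (* On forests [parent] inverts [parent_arcs]; all other choices of parents contain a circuit and
     contribute determinant 0. *)
  pose parent (F : {set 'I_n * 'I_n}) : {ffun 'I_n -> option 'I_n} :=
    [ffun i => [pick k | (k, i) \in F]].
  rewrite (reindex_onto parent_arcs parent) /=; last first.
    move=> F /andP[_ /forallP deg].
    apply/setP=> -[a b].
    rewrite in_parent_arcs ffunE.
    case: pickP => [k kF|->] //; apply/eqP/idP => [[<-//]|aF].
    have /card_le1_eqP := deg b => /(_ (k, b) (a, b)).
    by rewrite !inE kF aF eqxx => /(_ isT isT)[->].
  rewrite [RHS](bigID (fun f => has_circuit (parent_arcs f))) /=.
  rewrite [X in _ = X + _]big1 ?add0r => [|f /det_parent_mx_circuit->]; last first.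
    by rewrite mulr0.
  apply: eq_big => [f|f /andP[]].
    rewrite diverging_parent_arcs; apply: andb_idr => _.
    apply/eqP/ffunP=> i; rewrite ffunE.
    case: pickP => [k|no]; first by rewrite in_parent_arcs => /eqP.
    by case fi: (f i) => [k|//]; have := no k; rewrite in_parent_arcs fi eqxx.
  rewrite diverging_parent_arcs => acyc _.
  by rewrite prod_parent_arcs det_parent_mx_forest // mulr1.
have entryE i j : (i == j)%:R * (1 + \sum_k w k i) - w j i =
    \sum_o c i o * ((i == j)%:R - (o == Some j)%:R).
  rewrite sum_option /= subr0 mul1r.
  under [in RHS]eq_bigr => k _ do rewrite mulrBr.
  rewrite sumrB -mulr_suml [X in _ + (_ - X)](bigD1 j) //= eqxx mulr1.
  rewrite [X in _ + (_ - (_ + X))]big1 => [|k k_neqj]; last first.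
    by rewrite [Some k == _](negPf k_neqj) mulr0.
  by rewrite addr0 mulrDr mulr1 [(\sum_k _) * _]mulrC addrA.
rewrite /determinant.
under eq_bigr => s _.
  under eq_bigr => i _ do rewrite mxE entryE.
  rewrite bigA_distr_bigA mulr_sumr.
  over.
rewrite exchange_big; apply: eq_bigr => f _ /=.
rewrite mulr_sumr; apply: eq_bigr => s _.
rewrite big_split mulrCA /=; congr (_ * (_ * _)).
by apply: eq_bigr => i _; rewrite mxE.
Qed.
End ForestDeterminant.

(** * Number of arcs against number of weak components *)

Section ForestDimension.

Variable n : nat.
Implicit Type F : {set 'I_n * 'I_n}.

(** With indegrees at most 1, an arc is determined by its endpoint. *)
Lemma card_forest F :
  (forall i, (indegree F i <= 1)%N) -> #|F| = #|[set i | indegree F i != 0%N]|.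
Proof.
move=> deg; have inj : {in F &, injective (fun a : 'I_n * 'I_n => a.2)}.
  move=> a b aF bF ab; have /card_le1_eqP := deg a.2; apply.
    by rewrite inE bF ab eqxx.
  by rewrite inE aF eqxx.
rewrite -(card_in_imset inj); apply/eq_card => i; rewrite inE.
rewrite /indegree cards_eq0; apply/imsetP/set0Pn => -[a].
  by move=> aF ->; exists a; rewrite inE aF eqxx.
by rewrite inE => /andP[aF /eqP<-]; exists a.
Qed.

(** Every component contains a vertex of indegree 0, and the arcs are counted by the vertices of
    nonzero indegree. *)
Lemma card_weak_components F :
  diverging_forest F -> (#|F| + weak_components F <= n)%N.
Proof.
case/andP=> acyc /forallP deg.
set e := fun i j => arc_rel F i j || arc_rel F j i.
have e_sym : connect_sym e.
  by apply: sym_connect_sym => i j; rewrite /e orbC.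
(* Otherwise iterating the parent map inside a component closes a circuit. *)
have has_root x : exists2 r, connect e x r & indegree F r == 0%N.
  apply/exists_inP; apply: contraNT acyc => /exists_inPn no_root.
  pose g i := odflt i [pick k | (k, i) \in F].
  have gF i : connect e x i -> (g i, i) \in F.
    move/no_root; rewrite -/(indegree F i) /indegree cards_eq0 => /set0Pn[[k j]].
    rewrite inE => /andP[kF /eqP/= ji]; rewrite ji in kF.
    by rewrite /g; case: pickP => // /(_ k); rewrite kF.
  have gC k : connect e x (iter k g x).
    elim: k => //= k IH; apply: (connect_trans IH); apply: connect1.
    by rewrite /e /arc_rel gF ?orbT.
  (* By finiteness the iterates of [g] return to an earlier one, [y], from which they run through a
     cycle. *)
  have /loopingP/(_ (fingraph.order g x)) := looping_order g x.
  case/trajectP=> k lt_k eq_k.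
  pose y := iter k g x.
  have gyC j : connect e x (iter j g y) by rewrite /y -iterD.
  have gc : fcycle g (fingraph.orbit g y).
    apply/(orbitPcycle 3 0); exists (fingraph.order g x - k).-1.
    by rewrite prednK ?subn_gt0 // /y -iterD subnK ?eq_k // ltnW.
  apply: (fcycle_has_circuit _ (orbit_uniq _ _) gc).
    by rewrite -size_eq0 size_orbit -lt0n fingraph.order_gt0.
  by move=> z; rewrite -fconnect_orbit => /iter_findex <-; apply: gF.
pose rt x := odflt x [pick r | connect e x r && (indegree F r == 0%N)].
have rtP x : connect e x (rt x) && (indegree F (rt x) == 0%N).
  rewrite /rt; case: pickP => //= no.
  by case: (has_root x) => r xr r0; have := no r; rewrite xr r0.
rewrite card_forest //.
have -> : weak_components F = #|rt @: [set x | roots e x]|.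
  rewrite card_in_imset => [|x y]; last first.
    rewrite !inE => /eqP rx /eqP ry rxy; rewrite -rx -ry.
    apply/(fingraph.rootP e_sym).
    have /andP[xr _] := rtP x; have /andP[yr _] := rtP y.
    by apply: connect_trans xr _; rewrite rxy e_sym.
  by rewrite /weak_components /n_comp_mem; apply: eq_card => x; rewrite !inE andbT.
rewrite -[leqRHS]card_ord -(cardsC [set i | indegree F i != 0%N]) leq_add2l.
apply/subset_leq_card/subsetP=> _ /imsetP[x _ ->]; rewrite !inE negbK.
by case/andP: (rtP x).
Qed.

Lemma forest_dim_le (R : realFieldType) (G : wdigraph R n) F :
  F \in out_forests G -> (#|F| <= n - forest_dim G)%N.
Proof.
move=> FG; have := FG; rewrite inE => /andP[_ /card_weak_components].
have le_v : (forest_dim G <= weak_components F)%N.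
  rewrite /forest_dim -Order.NatOrder.minEnat -leEnat.
  exact: bigmin_le_cond.
move=> le_n; have vF_n : (forest_dim G + #|F| <= n)%N.
  by rewrite addnC; apply: leq_trans le_n; rewrite leq_add2l.
by rewrite leq_subRL // (leq_trans _ vF_n) // leq_addr.
Qed.

End ForestDimension.

(** * Comparing degrees of polynomials on the nonnegative axis *)

Section EventualSign.

Variable R : realFieldType.
Implicit Types p q : {poly R}.

(** Induction on [p * 'X + c]: a margin [d] uniform in [t], rather than mere negativity, lets the
    product with [t] absorb [c]. *)
Lemma lead_coef_lt0_eventually p :
  lead_coef p < 0 ->
  exists2 d, 0 < d & exists2 t0, 0 <= t0 & forall t, t0 <= t -> p.[t] <= - d.
Proof.
elim/poly_ind: p => [|p c IH]; first by rewrite lead_coef0 ltxx.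
have [->|p_neq0] := eqVneq p 0.
  rewrite mul0r add0r lead_coefC => c_lt0; exists (- c); first by rewrite oppr_gt0.
  by exists 0 => // t _; rewrite hornerC opprK.
rewrite lead_coefDl ?lead_coefMX; last first.
  by rewrite size_mulX // (leq_ltn_trans (size_polyC_leq1 _)) // ltnS size_poly_gt0.
case/IH=> d d_gt0 [t0 t0_ge0 pt]; exists 1 => //.
(* Beyond this threshold [d * t] is at least |c| + 1, so the new polynomial is at most -1. *)
exists (Num.max t0 ((`|c| + 1) / d)); first by rewrite le_max t0_ge0.
move=> t; rewrite ge_max => /andP[t0t]; rewrite ler_pdivrMr // => ct.
rewrite hornerMXaddC; have t_ge0 := le_trans t0_ge0 t0t.
have := ler_wpM2r t_ge0 (pt _ t0t); rewrite mulNr [d * t]mulrC => ptt.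
rewrite -lerBrDr (le_trans ptt) // -opprD lerN2 (le_trans _ ct) // addrC lerD2r.
exact: ler_norm.
Qed.

(** If [p] had the larger degree, a negative leading coefficient would contradict 0 <= p for large
    [t], and a positive one p <= q, through [q - p]. *)
Lemma size_le_of_bounded p q :
  (forall t, 0 <= t -> 0 <= p.[t] <= q.[t]) -> (size p <= size q)%N.
Proof.
move=> pq; rewrite leqNgt; apply/negP=> lt_qp.
have p_neq0 : lead_coef p != 0.
  by rewrite lead_coef_eq0 -size_poly_gt0 (leq_ltn_trans _ lt_qp).
have [p_lt0|p_gt0|/eqP] := ltgtP (lead_coef p) 0; last by rewrite (negPf p_neq0).
  have [d d_gt0 [t t_ge0 /(_ t (lexx t)) pt]] := lead_coef_lt0_eventually p_lt0.
  have /andP[p_ge0 _] := pq t t_ge0.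
  by have := le_trans p_ge0 pt; rewrite oppr_ge0 leNgt d_gt0.
have : lead_coef (q - p) < 0.
  by rewrite addrC lead_coefDl ?size_polyN // lead_coefN oppr_lt0.
case/lead_coef_lt0_eventually=> d d_gt0 [t t_ge0 /(_ t (lexx t))].
rewrite hornerD hornerN => qpt; have /andP[_] := pq t t_ge0.
by rewrite -subr_ge0 => /le_trans/(_ qpt); rewrite oppr_ge0 leNgt d_gt0.
Qed.

End EventualSign.

(** * Bounds on the resolvent by the minimum principle *)

Section KirchhoffResolvent.

Variables (R : realFieldType) (n : nat) (G : wdigraph R n).

Let L := Kirchhoff G.

Lemma Kirchhoff_mulE (x : 'cV[R]_n) i :
  (L *m x) i 0 = \sum_k eps G k i * (x i 0 - x k 0).
Proof.
rewrite mxE (bigD1 i) //= mxE eqxx sumrN opprK mulr_suml.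
rewrite [RHS](bigD1 i) //= subrr mulr0 add0r -big_split /=.
apply: eq_bigr => k k_neqi.
by rewrite mxE (negPf k_neqi) mulrBr mulNr.
Qed.

Lemma Kirchhoff_ones : L *m const_mx 1 = 0 :> 'cV_n.
Proof.
apply/colP=> i; rewrite Kirchhoff_mulE [RHS]mxE big1 // => k _.
by rewrite !mxE subrr mulr0.
Qed.

(* Minimum principle, evaluated at a vertex where [x] is minimal. *)
Lemma resolvent_min_principle t (x : 'cV[R]_n) : 0 <= t ->
  (forall i, 0 <= ((1%:M + t *: L) *m x) i 0) -> forall i, 0 <= x i 0.
Proof.
move=> t_ge0 Ax_ge0 i; pose m := [arg min_(k < i) x k 0]%O.
have min_m k : x m 0 <= x k 0 by rewrite /m; case: arg_minP => // j _; exact.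
apply: le_trans (min_m i); apply: le_trans (Ax_ge0 m) _.
rewrite mulmxDl mul1mx -scalemxAl 2!mxE Kirchhoff_mulE.
(* All differences [x m 0 - x k 0] are nonpositive, so [L *m x] is nonpositive at [m]. *)
rewrite gerDl mulr_ge0_le0 // sumr_le0 // => k _.
by rewrite mulr_ge0_le0 ?eps_ge0 // subr_le0.
Qed.

(** The minimum principle applies to a kernel vector and to its negative. *)
Lemma resolvent_unit t : 0 <= t -> 1%:M + t *: L \in unitmx.
Proof.
move=> t_ge0; rewrite -unitmx_tr unitmxE unitfE.
apply/det0P=> -[v v_neq0] /(congr1 trmx).
rewrite trmx_mul trmxK trmx0 => Av0; case/eqP: v_neq0.
have cv_ge0 c i : 0 <= c * v 0 i.
  suff: 0 <= (c *: v^T) i 0 by rewrite !mxE.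
  apply: (resolvent_min_principle t_ge0) => j.
  by rewrite -scalemxAr Av0 scaler0 mxE.
apply/rowP=> i; rewrite mxE; apply/le_anti.
by have := cv_ge0 1 i; have := cv_ge0 (-1) i; rewrite mulN1r mul1r oppr_ge0 => -> ->.
Qed.

(** The matrix maps each column of its inverse to a unit vector, which gives nonnegativity; it fixes
    the all-ones vector, so the inverse has row sums 1. *)
Lemma resolvent_entry_bounds t i j : 0 <= t ->
  0 <= invmx (1%:M + t *: L) i j <= 1.
Proof.
move=> t_ge0; set A := 1%:M + t *: L.
have uA : A \in unitmx := resolvent_unit t_ge0.
have B_ge0 a b : 0 <= invmx A a b.
  suff: 0 <= col b (invmx A) a 0 by rewrite mxE.
  apply: (resolvent_min_principle t_ge0) => k.
  by rewrite colE mulmxA mulmxV // mul1mx mxE ler0n.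
rewrite B_ge0 /=.
have : invmx A *m const_mx 1 = const_mx 1 :> 'cV_n.
  rewrite -[X in _ *m X](_ : A *m const_mx 1 = const_mx 1) ?mulKmx //.
  by rewrite mulmxDl mul1mx -scalemxAl Kirchhoff_ones scaler0 addr0.
move/colP/(_ i); rewrite !mxE (bigD1 j) //= mxE mulr1 => <-.
by rewrite lerDl sumr_ge0 // => k _; rewrite mxE mulr1.
Qed.

End KirchhoffResolvent.

(** * The forest polynomial as a determinant *)

Section ForestPolynomial.

Variables (R : realFieldType) (n : nat) (G : wdigraph R n).

Let L := Kirchhoff G.

Definition forest_poly : {poly R} :=
  \sum_(F in out_forests G) weight G F *: 'X^#|F|.

Definition resolvent_poly_mx : 'M[{poly R}]_n :=
  1%:M + 'X *: map_mx polyC L.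

(** This is [det_forest] with each arc weight multiplied by X; forests using an absent arc have
    weight 0. *)
Lemma det_resolvent_poly_mx : \det resolvent_poly_mx = forest_poly.
Proof.
pose w k i : {poly R} := eps G k i *: 'X.
have -> : resolvent_poly_mx =
    \matrix_(i, j) ((i == j)%:R * (1 + \sum_k w k i) - w j i).
  apply/matrixP=> i j; rewrite !mxE [j == i]eq_sym.
  case: eqVneq => [<-|_]; last by rewrite mul0r !add0r polyCN mulrN mulrC mul_polyC.
  rewrite mul1r /w eps_loopless scale0r subr0; congr (1 + _).
  rewrite sumrN opprK mulrC mul_polyC -scaler_suml [in RHS](bigD1 i) //=.
  by rewrite eps_loopless add0r.
rewrite det_forest (bigID (fun F : {set 'I_n * 'I_n} => F \subset arcs G)) /=.
rewrite [X in _ + X]big1 ?addr0 => [|F /andP[_ /subsetPn[a aF]]]; last first.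
  rewrite inE -leNgt => eps_le0; rewrite (bigD1 a) //= /w.
  have -> : eps G a.1 a.2 = 0 by apply/le_anti; rewrite eps_le0 eps_ge0.
  by rewrite scale0r mul0r.
apply: eq_big => [F|F _]; first by rewrite inE andbC.
by rewrite /w scaler_prod prodr_const.
Qed.

Lemma total_weight_cond (P : pred {set 'I_n * 'I_n}) :
  total_weight G [set F : {set 'I_n * 'I_n} in out_forests G | P F] =
  \sum_(F in out_forests G | P F) weight G F.
Proof. by apply: eq_bigl => F; rewrite in_set. Qed.

Lemma coef_forest_poly k : forest_poly`_k = sigma G k.
Proof.
rewrite /forest_poly coef_sum /sigma total_weight_cond.
rewrite big_mkcondr; apply: eq_bigr => F _.
by rewrite coefZ coefXn eq_sym; case: eqP; rewrite ?mulr1 ?mulr0.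
Qed.

Lemma size_forest_poly : (size forest_poly <= (n - forest_dim G).+1)%N.
Proof.
apply/leq_sizeP=> k lt_k; rewrite /forest_poly coef_sum big1 // => F.
move/forest_dim_le=> le_F.
by rewrite coefZ coefXn gtn_eqF ?mulr0 // (leq_ltn_trans le_F).
Qed.

Lemma weight_ge0 F : 0 <= weight G F.
Proof. by apply: prodr_ge0 => a _; exact: eps_ge0. Qed.

Lemma forest_poly_ge0 t : 0 <= t -> 0 <= forest_poly.[t].
Proof.
move=> t_ge0; rewrite horner_sum sumr_ge0 // => F _.
by rewrite hornerZ hornerXn mulr_ge0 ?weight_ge0 ?exprn_ge0.
Qed.

Lemma horner_resolvent t :
  map_mx (horner_eval t) resolvent_poly_mx = 1%:M + t *: L.
Proof.
apply/matrixP=> i j; rewrite mxE /horner_eval !mxE.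
by rewrite hornerD hornerM hornerX !hornerE hornerMn hornerC.
Qed.

Lemma det_resolvent t : \det (1%:M + t *: L) = forest_poly.[t].
Proof. by rewrite -horner_resolvent det_map_mx det_resolvent_poly_mx. Qed.

(** Cofactors alone give degree at most n - 1; the entry bounds of the resolvent sharpen this to n -
    v. *)
Lemma size_adj_resolvent i j :
  (size (\adj resolvent_poly_mx i j) <= (n - forest_dim G).+1)%N.
Proof.
apply: leq_trans size_forest_poly; apply: size_le_of_bounded => t t_ge0.
(* Evaluation commutes with the adjugate, which at an invertible matrix is the determinant times the
   inverse. *)
have -> : (\adj resolvent_poly_mx i j).[t] =
    forest_poly.[t] * invmx (1%:M + t *: L) i j.
  have uA : 1%:M + t *: L \in unitmx := resolvent_unit G t_ge0.
  rewrite /invmx uA [in RHS]mxE mulrA -det_resolvent divff ?mul1r -?unitfE -?unitmxE //.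
  have /matrixP/(_ i j) := map_mx_adj (horner_eval t) resolvent_poly_mx.
  by rewrite horner_resolvent [LHS]mxE.
have /andP[B_ge0 B_le1] := resolvent_entry_bounds G i j t_ge0.
have d_ge0 := forest_poly_ge0 t_ge0.
by rewrite mulr_ge0 //= ler_piMr.
Qed.

(** * Coefficient matrices of the adjugate *)

Let B k : 'M[R]_n := map_mx (coefp k) (\adj resolvent_poly_mx).

(** Compare coefficients of X^k in (I + X L) adj(I + X L) = sigma(X) I. *)
Lemma coef_adj_resolvent k :
  B k = (sigma G k)%:M - (if k is k'.+1 then L *m B k' else 0).
Proof.
have := mul_mx_adj resolvent_poly_mx.
rewrite det_resolvent_poly_mx mulmxDl mul1mx -scalemxAl => adjE.
apply/eqP; rewrite eq_sym subr_eq; apply/eqP/matrixP=> i j.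
have /(congr1 (coefp k)) := congr1 (fun M : 'M_n => M i j) adjE.
rewrite !mxE /= coefD coefXM coefMn coef_forest_poly => <-; congr (_ + _).
case: k => [|k] /=; rewrite !mxE // coef_sum; apply: eq_bigr => l _.
by rewrite !mxE /= coefCM.
Qed.

(** The partial sums satisfy S_(m+1) = s_(m+1) I - L S_m, so each step multiplies the earlier terms
    by -L. *)
Lemma sum_coef_adj_resolvent m :
  \sum_(0 <= k < m.+1) B k = \sum_(0 <= i < m.+1) sigma_le G (m - i) *: (- L) ^+ i.
Proof.
elim: m => [|m IH].
  by rewrite !big_nat1 coef_adj_resolvent subr0 /sigma_le big_nat1 expr0 scalemx1.
transitivity ((sigma_le G m.+1)%:M - L *m \sum_(0 <= k < m.+1) B k).
  rewrite big_nat_recl // coef_adj_resolvent subr0.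
  under eq_bigr => k _ do rewrite coef_adj_resolvent.
  rewrite sumrB -mulmx_sumr addrA; congr (_ - _).
  rewrite /sigma_le [in RHS]big_nat_recl // raddfD; congr (_ + _).
  exact/esym/raddf_sum.
rewrite IH [RHS]big_nat_recl // subn0 expr0 scalemx1 -mulNmx mulmx_sumr.
congr (_ + _); apply: eq_bigr => i _.
by rewrite -scalemxAr exprS subSS.
Qed.

(** By the degree bound the sum contains every nonzero coefficient, so it is the value of the
    adjugate at X = 1. *)
Lemma adj_resolvent1 :
  \adj (1%:M + L) = \sum_(0 <= k < (n - forest_dim G).+1) B k.
Proof.
rewrite -[L]scale1r -horner_resolvent -map_mx_adj.
apply/matrixP=> i j; rewrite [LHS]mxE summxE /= /horner_eval.
rewrite (horner_coef_wide _ (size_adj_resolvent i j)) big_mkord.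
by apply: eq_bigr => k _; rewrite expr1n mulr1 [RHS]mxE.
Qed.

Lemma sum_sigma :
  \sum_(0 <= k < (n - forest_dim G).+1) sigma G k = forest_poly.[1].
Proof.
rewrite (horner_coef_wide _ size_forest_poly) big_mkord.
by apply: eq_bigr => k _; rewrite expr1n mulr1 coef_forest_poly.
Qed.

Lemma forest_poly1 : forest_poly.[1] = total_weight G (out_forests G).
Proof.
rewrite horner_sum; apply: eq_bigr => F _.
by rewrite hornerZ hornerXn expr1n mulr1.
Qed.

Lemma sigma_leE k :
  sigma_le G k =
  total_weight G [set F : {set 'I_n * 'I_n} in out_forests G | (#|F| <= k)%N].
Proof.
rewrite /sigma_le total_weight_cond big_mkcondr /=.
under eq_bigr => j _ do rewrite /sigma total_weight_cond big_mkcondr.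
rewrite exchange_big /=; apply: eq_bigr => F _.
(* Each forest is counted once, at [j] equal to its number of arcs. *)
rewrite -big_mkcond; under eq_bigl => j do rewrite eq_sym.
by rewrite (big_nat1_eq _ (fun=> weight G F)) /= ltnS.
Qed.

End ForestPolynomial.

(** * Expansion of the inverse at X = 1 *)

Theorem theorem8 (R : realFieldType) (n : nat) (hn : (1 < n)%N)
    (G : wdigraph R n) :
  let L := Kirchhoff G in
  let v := forest_dim G in
  let s := \sum_(0 <= k < (n - v).+1) sigma G k in
  [/\ 1%:M + L \in unitmx,
      Q G 1 = invmx (1%:M + L),
      invmx (1%:M + L) = s^-1 *: \sum_(0 <= i < (n - v).+1) sigma_le G (n - v - i) *: (- L) ^+ i,
      forall k : nat, (k <= n - v)%N ->
        sigma_le G k = total_weight G [set F : {set 'I_n * 'I_n} in out_forests G | (#|F| <= k)%N]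
    & s = total_weight G (out_forests G)].
Proof.
move=> L v s.
have uA : 1%:M + L \in unitmx by rewrite -[L]scale1r resolvent_unit.
split=> // [| |k _|].
- by rewrite /Q scale1r.
(* The inverse is the adjugate divided by the determinant, which is sigma(1) = s. *)
- by rewrite /invmx uA adj_resolvent1 sum_coef_adj_resolvent -[in \det _](scale1r L)
    det_resolvent -sum_sigma.
- exact: sigma_leE.
by rewrite /s sum_sigma forest_poly1.
Qed.
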